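(* Let $J=\{(2n+1)2^{2k}-1 \mid n,k\in\mathbb{N}\}$, where $\mathbb{N}=\{0,1,2,\ldots\}$. For an integer $m\ge 1$ let $\mathrm{Sym}_m$ denote the set of permutations of $\{0,1,\ldots,m-1\}$. (J1) For every integer $m\ge 1$, the number of permutations $\sigma\in\mathrm{Sym}_m$ such that $i+\sigma(i)\in J$ for all $i=0,1,\ldots,m-1$ is odd. (J2) For every integer $m\ge 1$, the number of permutations $\sigma\in\mathrm{Sym}_m$ such that $i+\sigma(i)\in J$ for all $i=0,1,\ldots,m-2$ (no condition on $i=m-1$) is odd.
   Context: $\mathbb{N}$ denotes the set of non-negative integers. Thus $J=\{0,2,3,4,6,8,10,11,\ldots\}$. *)

(* Defs.v *)
From mathcomp Require Import all_boot all_fingroup.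
From mathcomp Require Import classical_sets.

Set Implicit Arguments.
Unset Strict Implicit.
Unset Printing Implicit Defensive.

(* The truncated subtraction is exact: the product is positive.  Membership
   [j \in J] is the classical boolean of [J j]. *)
Definition J : classical_sets.set nat :=
  [set j | exists n k : nat, j = (2 * n + 1) * 2 ^ (2 * k) - 1]%classic.

(* Main.v *)
Require Import Defs.
From mathcomp Require Import all_boot all_fingroup.
From mathcomp Require Import classical_sets.
From mathcomp Require Import all_algebra zify.

Import GRing.Theory.

(** Modulo 2 the two counts are determinants over the field with two elements
    (here [bool]): of the Hankel matrix [H = (i + j \in J)], and of [H] with its
    last row replaced by ones.  The generating series of [J] modulo 2 has the
    Jacobi continued fraction with diagonal coefficients [0, 1, 1, 1, ...] and
    all off-diagonal coefficients [1]; if [T] is the corresponding tridiagonal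
    operator and the [i]-th row of [L] is [T^i e_0], this means [H = L L^T] with
    [L] unitriangular.  Since moreover every row of [L] sums to [1], replacing
    the last row of [L] by ones in the left factor replaces the last row of [H]
    by ones. *)

Lemma logn2_inJ (j : nat) : (j \in J) = ~~ odd (logn 2 j.+1).
Proof.
apply/idP/idP => [|ev].
  rewrite in_setE => -[n [k ->]].
  rewrite subn1 prednK ?muln_gt0 ?expn_gt0 ?addn1 //.
  rewrite lognM ?expn_gt0 // pfactorK // oddD !mul2n odd_double addbF.
  by rewrite lognE dvdn2 /= odd_double.
rewrite in_setE.
have /(pfactor_coprime (isT : prime 2)) [n] : 0 < j.+1 by [].
rewrite coprime2n => on jE.
exists n./2, (logn 2 j.+1)./2.
have -> : (2 * n./2 + 1 = n)%N by lia.
have -> : (2 * (logn 2 j.+1)./2 = logn 2 j.+1)%N by lia.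
by rewrite -jE subn1.
Qed.

Lemma J_double (n : nat) : n.*2 \in J.
Proof. by rewrite logn2_inJ lognE dvdn2 /= odd_double. Qed.

Lemma J_doubleS (n : nat) : (n.*2.+1 \in J) = (n \notin J).
Proof.
by rewrite !logn2_inJ -doubleS -mul2n lognM // (logn_prime 2).
Qed.

(** In [bool], [-1 = 1], so all signs vanish from the Leibniz expansion. Each product is a
    conjunction, and the sum counts modulo 2. *)
Lemma odd_card_perm (m : nat) (P : 'I_m -> 'I_m -> bool) :
  odd #|[set s : 'S_m | [forall i, P i (s i)]]|
  = (\det (\matrix_(i, j) P i j : 'M[bool]_m))%R.
Proof.
have -> k : odd k = (k%:R : bool)%R by elim: k => //= k ->; rewrite mulrS.
rewrite -sum1_card natr_sum big_mkcond; apply: eq_bigr => s _.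
have -> : ((-1) ^+ s = 1 :> bool)%R by case: (odd_perm s).
rewrite mul1r inE; under [RHS]eq_bigr do rewrite mxE.
transitivity [forall i, P i (s i)]; first by case: ifP.
by rewrite -[RHS]/(\big[andb/true]_i P i (s i)) big_andE.
Qed.

Section Jacobi.
Local Open Scope ring_scope.

Definition jacobi (u : nat -> bool) (k : nat) : bool :=
  (if k is k'.+1 then u k' + u k else 0) + u k.+1.

(** The operator is symmetric, so cutting the sums at [N] leaves only boundary terms. *)
Lemma jacobi_sym (u v : nat -> bool) (N : nat) :
  \sum_(k < N.+1) jacobi u k * v k + u N * v N.+1
  = \sum_(k < N.+1) u k * jacobi v k + u N.+1 * v N.
Proof.
elim: N => [|N IH].
  rewrite !big_ord_recl !big_ord0 /jacobi /=.
  by case: (u 0) (u 1) (v 0) (v 1) => [] [] [] [].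
rewrite big_ord_recr [in RHS]big_ord_recr /=.
move: IH; set a := \sum_(k < _) _; set b := \sum_(k < _) _; rewrite /jacobi.
by move: a b (u N) (u N.+1) (u N.+2) (v N) (v N.+1) (v N.+2)
  => [] [] [] [] [] [] [] [].
Qed.

(** Every column of the operator sums to 1 ([0 + 1] for the first, [1 + 1 + 1] for the others), so
    total sums are preserved up to the cut at [N]. *)
Lemma jacobi_sum (u : nat -> bool) (N : nat) :
  \sum_(k < N.+1) jacobi u k = \sum_(k < N.+1) u k + u N + u N.+1.
Proof.
elim: N => [|N IH].
  rewrite !big_ord_recl !big_ord0 /jacobi /=.
  by case: (u 0) (u 1) => [] [].
rewrite big_ord_recr [in RHS]big_ord_recr /= {}IH /jacobi.
set a := \sum_(k < _) _.
by move: a (u N) (u N.+1) (u N.+2) => [] [] [] [].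
Qed.

(** In the quadratic form the off-diagonal terms cancel in pairs; the diagonal gives the squares
    [u k * u k = u k], except at [k = 0]. *)
Lemma jacobi_diag (u : nat -> bool) (N : nat) :
  \sum_(k < N.+1) u k * jacobi u k
  = \sum_(k < N.+1) u k + u 0 + u N * u N.+1.
Proof.
elim: N => [|N IH].
  rewrite !big_ord_recl !big_ord0 /jacobi /=.
  by case: (u 0) (u 1) => [] [].
rewrite big_ord_recr [in RHS]big_ord_recr /= {}IH /jacobi.
set a := \sum_(k < _) _.
by move: a (u 0) (u N) (u N.+1) (u N.+2) => [] [] [] [] [].
Qed.

Definition stieltjes (n : nat) : nat -> bool :=
  iter n jacobi (fun k => k == 0%N).

Lemma stieltjes_gt (n k : nat) : (n < k)%N -> stieltjes n k = 0.
Proof.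
elim: n k => [|n IH] [|k] // ltnk.
by rewrite /stieltjes iterS -/(stieltjes n) /jacobi !IH //; lia.
Qed.

Lemma stieltjes_diag (n : nat) : stieltjes n n = 1.
Proof.
elim: n => [|n IH] //.
rewrite /stieltjes iterS -/(stieltjes n) /jacobi IH !stieltjes_gt //.
Qed.

Lemma stieltjes_sum (n N : nat) :
  (n <= N)%N -> \sum_(k < N.+1) stieltjes n k = 1.
Proof.
elim: n => [|n IH] leN.
  by rewrite big_ord_recl big1.
rewrite /stieltjes iterS -/(stieltjes n) jacobi_sum IH; last by lia.
by rewrite !stieltjes_gt //; lia.
Qed.

(** Symmetry moves the operator from the left factor to the right one, one power at a time; [N] is
    large enough for the boundary terms to vanish. *)
Lemma stieltjes_dot (i j N : nat) : (i + j <= N)%N ->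
  \sum_(k < N.+1) stieltjes i k * stieltjes j k = stieltjes (i + j) 0.
Proof.
elim: i j => [|i IH] j leN.
  rewrite big_ord_recl big1 ?addr0 ?mul1r // => k _; exact: mul0r.
have := jacobi_sym (stieltjes i) (stieltjes j) N.
rewrite !(@stieltjes_gt _ N.+1); [|lia|lia].
rewrite mulr0 mul0r !addr0 => ->.
by rewrite (IH j.+1) ?addnS ?addSn // -addSnnS.
Qed.

(** With [v = stieltjes n], the moment of index [2n] is the sum of [v k * v k = v k], namely 1, and
    that of index [2n + 1] is the quadratic form at [v], namely [1 + v 0]. Membership in [J] obeys
    the same recursion. *)
Lemma stieltjes0 (n : nat) : stieltjes n 0 = (n \in J).
Proof.
elim/ltn_ind: n => n IH.
rewrite -[n]odd_double_half; case nE: (odd n); rewrite ?add1n ?add0n.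
  rewrite J_doubleS -IH; last by lia.
  rewrite -addnn -addnS -(@stieltjes_dot _ _ _ (leqnn _)).
  set N := (_ + _)%N; rewrite /stieltjes iterS -/(stieltjes _).
  rewrite jacobi_diag stieltjes_sum; last by lia.
  by rewrite (@stieltjes_gt _ N.+1) ?mulr0 ?addr0 //; lia.
rewrite J_double -addnn -(@stieltjes_dot _ _ _ (leqnn _)).
under eq_bigr do rewrite -[_ * _]/(_ && _) andbb.
by rewrite stieltjes_sum ?leq_addr.
Qed.

Lemma stieltjes_dot_inJ (i j N : nat) : (i <= N)%N -> (j <= N)%N ->
  \sum_(k < N.+1) stieltjes i k * stieltjes j k = (i + j \in J)%N.
Proof.
move=> leiN lejN; rewrite -stieltjes0.
(* The range is enlarged to satisfy [i + j <= N + N]; the added terms have [k > i] and vanish. *)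
rewrite -(@stieltjes_dot i j (N + N)) ?leq_add // -addSn big_split_ord /=.
rewrite [X in _ = _ + X]big1 ?addr0 //= => k _.
by rewrite stieltjes_gt ?mul0r //; lia.
Qed.

Lemma det_unitrig (R : comNzRingType) (m : nat) (A : 'M[R]_m) :
  (forall i j : 'I_m, (i < j)%N -> A i j = 0) ->
  (forall i, A i i = 1) -> \det A = 1.
Proof.
by move=> /is_trig_mxP Atrig A1; rewrite det_trig // big1.
Qed.

Lemma det_stieltjes (m : nat) :
  \det (\matrix_(i < m, k < m) stieltjes i k) = 1.
Proof.
apply: det_unitrig => [i j ltij|i]; rewrite mxE; first exact: stieltjes_gt.
exact: stieltjes_diag.
Qed.

End Jacobi.

Theorem theoremJ :
  (forall m : nat, 1 <= m ->
     odd #|[set s : 'S_m | [forall i : 'I_m, (i + s i)%N \in J]]|) /\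
  (forall m : nat, 1 <= m ->
     odd #|[set s : 'S_m |
             [forall i : 'I_m, (i < m.-1) ==> ((i + s i)%N \in J)]]|).
Proof.
split=> -[//|m] _.
  rewrite (@odd_card_perm _ (fun i j : 'I_m.+1 => (i + j)%N \in J)).
  pose L : 'M[bool]_m.+1 := (\matrix_(i, k) stieltjes i k)%R.
  have -> : (\matrix_(i, j) ((i + j)%N \in J) = L *m L^T)%R.
    apply/matrixP => i j; rewrite !mxE -(@stieltjes_dot_inJ i j m) ?leq_ord //.
    by apply: eq_bigr => k _; rewrite !mxE.
  by rewrite det_mulmx det_tr det_stieltjes.
rewrite (@odd_card_perm _
  (fun i j : 'I_m.+1 => (i < m) ==> ((i + j)%N \in J))).
pose L : 'M[bool]_m.+1 := (\matrix_(i, k) stieltjes i k)%R.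
pose L1 : 'M[bool]_m.+1 := (\matrix_(i, k) ((i < m)%N ==> stieltjes i k))%R.
have -> : (\matrix_(i, j) ((i < m)%N ==> ((i + j)%N \in J)) = L1 *m L^T)%R.
  apply/matrixP => i j; rewrite !mxE.
  under eq_bigr do rewrite !mxE; case: ltnP => _ /=.
    by rewrite (@stieltjes_dot_inJ i j m) ?leq_ord.
  under eq_bigr do rewrite mul1r.
  by rewrite stieltjes_sum ?leq_ord.
(* [L1] is still unitriangular: its last row, now all ones, has no entry above the diagonal. *)
rewrite det_mulmx det_tr det_stieltjes mulr1 det_unitrig // => [i j ltij|i].
  by rewrite mxE stieltjes_gt // (leq_trans ltij (leq_ord j)).
by rewrite mxE stieltjes_diag implybT.
Qed.
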